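(* Let $M \in \mathbb{Z}^{m\times n}$ be an $m \times n$ (not necessarily totally) unimodular matrix. For all $\bm{b},\bm{b}^-,\bm{b}^+ \in \mathbb{Z}^m$ such that $\bm{b} = \frac{\bm{b}^- + \bm{b}^+}{2}$, we have \[ \#\{\bm{y} \in \mathbb{Z}_{\geq 0}^n \mid M\bm{y} = \bm{b}\}^2 \;\geq\; \#\{\bm{y} \in \mathbb{Z}_{\geq 0}^n \mid M\bm{y} = \bm{b}^-\} \cdot \#\{\bm{y} \in \mathbb{Z}_{\geq 0}^n \mid M\bm{y} = \bm{b}^+\}, \] given that all three of these sets are finite.
   Context: An integer matrix $M$ is unimodular if all of its non-singular $\operatorname{rank}(M)\times\operatorname{rank}(M)$ submatrices have determinant $\pm1$. *)

(* Defs.v *)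
From mathcomp Require Import all_boot all_order all_algebra finmap.
From mathcomp Require Import boolp classical_sets functions cardinality.
Set Implicit Arguments.
Unset Strict Implicit.
Unset Printing Implicit Defensive.
Import Order.TTheory GRing.Theory Num.Theory.
Local Open Scope classical_set_scope.
Local Open Scope ring_scope.

(* [\rank] needs a field, hence the embedding into the rationals. *)
Definition int_rank (m n : nat) (M : 'M[int]_(m, n)) : nat :=
  \rank (map_mx intr M : 'M[rat]_(m, n)).

(* A submatrix is given by strictly increasing row and column selections. If
   [int_rank M] is 0, the only one is the empty matrix, of determinant 1. *)
Definition unimodular (m n : nat) (M : 'M[int]_(m, n)) : Prop :=
  forall (f : 'I_(int_rank M) -> 'I_m) (g : 'I_(int_rank M) -> 'I_n),
    {homo f : i j / (i < j)%N} -> {homo g : i j / (i < j)%N} ->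
    \det (mxsub f g M) != 0 ->
    \det (mxsub f g M) = 1 \/ \det (mxsub f g M) = -1.

Definition nonneg_solutions (m n : nat) (M : 'M[int]_(m, n)) (b : 'cV[int]_m) :
    set 'cV[int]_n :=
  [set y : 'cV[int]_n | (forall j, 0 <= y j 0) /\ M *m y = b].

(* [fset_set] sends infinite sets to the empty one, so this is the cardinality
   only under a [finite_set] hypothesis. *)
Definition num_solutions (m n : nat) (M : 'M[int]_(m, n)) (b : 'cV[int]_m) :
    nat :=
  (#|` fset_set (nonneg_solutions M b)|)%fset.

(* Main.v *)
(* The number of pairs with sum [s] in the fibers over [bm] and [bp] is the
   number of points of the box [0, s] in the fiber over [bm], so it suffices
   that, among all fibers of [M] on a box [l, u] with [M (l + u) = 2 b], the one
   over [b] has the most lattice points. Let [A] be another fiber and [C] the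
   central one. For [w <> 0] in the kernel of [M], the pairs of points of [A] (or
   of [C]) with difference [w] are counted by the fibers of a strictly smaller
   box, whose ends add up to [l + u + w], so the center is again [b]. By
   induction [#|A|^2 - #|A| <= #|C|^2 - #|C|], hence [#|A| <= #|C|] as soon as [C]
   is nonempty. Unimodularity only serves to round the real point [(l + u) / 2]
   of the central fiber to an integer one. *)
Require Import Defs.
From mathcomp Require Import all_boot all_order all_algebra finmap.
From mathcomp Require Import boolp classical_sets functions cardinality.
From mathcomp Require Import lra zify.
Set Implicit Arguments.
Unset Strict Implicit.
Unset Printing Implicit Defensive.
Import Order.TTheory GRing.Theory Num.Theory.
Local Open Scope classical_set_scope.
Local Open Scope ring_scope.

(** * Rounding inside a box under unimodularity *)

Lemma increasing_enum (n r : nat) (K : {set 'I_n}) : #|K| = r ->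
  exists g : 'I_r -> 'I_n,
    {homo g : i j / (i < j)%N} /\ (forall x, (x \in K) = (x \in codom g)).
Proof.
move=> <-; exists (fun i => enum_val i); split=> [i j lt_ij | x].
  have srt : sorted (relpre val ltn) (enum K).
    rewrite /enum_mem; apply: sorted_filter.
      by move=> ? ? ?; apply: ltn_trans.
    by rewrite -enumT -sorted_map val_enum_ord iota_ltn_sorted.
  have tr : transitive (relpre (@nat_of_ord n) ltn).
    by move=> ? ? ?; apply: ltn_trans.
  have := sorted_ltn_nth tr (enum_val i) srt => /(_ i j).
  rewrite !inE -!cardE !ltn_ord => /(_ isT isT lt_ij).
  by rewrite -!enum_val_nth.
apply/idP/codomP => [xK | [i ->]]; last exact: enum_valP.
by exists (enum_rank_in xK x); rewrite enum_rankK_in.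
Qed.

Lemma increasing_inj (m n : nat) (g : 'I_m -> 'I_n) :
  {homo g : i j / (i < j)%N} -> injective g.
Proof.
move=> gh i j eg; apply: val_inj; case: (ltngtP i j) => // /gh.
  by rewrite eg ltnn.
by rewrite eg ltnn.
Qed.

(** Linear independence of the rows indexed by [J], phrased with full-length vectors supported on
    [J] so that no submatrix has to be formed. *)
Definition free_rows (F : fieldType) (n m : nat) (A : 'M[F]_(n, m))
    (J : {set 'I_n}) : Prop :=
  forall u : 'rV[F]_n, (forall i, i \notin J -> u 0 i = 0) ->
    u *m A = 0 -> u = 0.

(** A maximal free set [K] above [J] is a basis of the row space, hence has [r] elements, and [g]
    lists it in increasing order, as [unimodular] asks. *)
Lemma extend_free_rows (F : fieldType) (n m r : nat) (A : 'M[F]_(n, m))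
    (J : {set 'I_n}) :
  \rank A = r -> free_rows A J ->
  exists g : 'I_r -> 'I_n,
    [/\ {homo g : i j / (i < j)%N}, row_free (rowsub g A)
      & forall x, x \in J -> x \in codom g].
Proof.
move=> rkA freeJ.
have [K /maxsetP[/asboolP freeK maxK] sJK] :
    {K | maxset [pred K : {set 'I_n} | `[< free_rows A K >]] K & J \subset K}.
  by apply: maxset_exists; apply/asboolP.
have [g [ghomo gK]] := increasing_enum (erefl #|K|).
have ginj := increasing_inj ghomo.
have freeg : row_free (rowsub g A).
  apply: inj_row_free => w w0.
  have weq : w *m rowsub g 1%:M = 0.
    apply: freeK => [i iK | ].
      rewrite mxE big1 // => k _; rewrite !mxE; case: eqP => [gk|_].
        by move: iK; rewrite gK -gk codom_f.
      by rewrite mulr0.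
    by rewrite -mulmxA mul_rowsub_mx mul1mx.
  apply/rowP => k; move/rowP: weq => /(_ (g k)).
  rewrite !mxE (bigD1 k) //= big1 ?addr0 => [|j jk]; rewrite !mxE.
    by rewrite eqxx mulr1.
  by rewrite (inj_eq ginj) (negPf jk) mulr0.
have rowsA i : (row i A <= rowsub g A)%MS.
  have [iK|iK] := boolP (i \in K).
    move: iK; rewrite gK => /codomP[k ->].
    by rewrite -row_rowsub row_sub.
  (* A row outside the span of [K] could be added to [K]: a relation with [u 0 i] nonzero could be
     solved for row [i]. *)
  apply/idPn => nsub.
  have : i |: K = K.
    apply: maxK; last exact: finset.subsetUr.
    apply/asboolP => u u0 uA.
    have ui0 : u 0 i = 0.
      apply: contraNeq nsub => ui.
      have -> : row i A = - (u 0 i)^-1 *: ((u - u 0 i *: delta_mx 0 i) *m A).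
        rewrite mulmxBl uA sub0r -scalemxAl -rowE scalerN scalerA.
        by rewrite mulNr mulVf // scaleN1r opprK.
      apply/scalemx_sub; rewrite mulmx_sum_row; apply: summx_sub => k _.
      have [->|ki] := eqVneq k i.
        by rewrite !mxE !eqxx mulr1 subrr scale0r sub0mx.
      have [kK|kK] := boolP (k \in K).
        apply/scalemx_sub; move: kK; rewrite gK => /codomP[j ->].
        by rewrite -row_rowsub row_sub.
      rewrite !mxE (negPf ki) andbF mulr0 subr0 u0 ?scale0r ?sub0mx //.
      by rewrite !inE negb_or ki.
    apply: freeK uA => k kK.
    by have [->//|ki] := eqVneq k i; apply: u0; rewrite !inE negb_or ki.
  by move=> iK'; move: iK; rewrite -iK' setU11.
have cardK : #|K| = r.
  apply/eqP; rewrite -(eqP freeg) -rkA eqn_leq; apply/andP; split.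
    by apply/mxrankS/row_subP => k; rewrite row_rowsub row_sub.
  by apply/mxrankS/row_subP.
case: r / cardK rkA => rkA; exists g; split=> // x xJ.
by rewrite -gK (fintype.subsetP sJK).
Qed.

(** Complete the columns in [J] to a column basis [g] and pick a row basis [f] of these columns. The
    block [N] on [f] and [g] has determinant 1 or -1, hence an integer inverse. The coordinates of
    [y] outside [g] are integers; moved to the right-hand side, they leave an integer system
    [N w = ...] for the others. *)
Lemma unimodular_integral (m n : nat) (M : 'M[int]_(m, n)) (J : {set 'I_n})
    (b : 'cV[int]_m) (y : 'cV[rat]_n) :
  unimodular M -> free_rows (map_mx intr M : 'M[rat]_(m, n))^T J ->
  (forall j, j \notin J -> y j 0 \is a Num.int) ->
  map_mx intr M *m y = map_mx intr b ->
  exists z : 'cV[int]_n, y = map_mx intr z.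
Proof.
move=> hM freeJ yint yb; pose Mq : 'M[rat]_(m, n) := map_mx intr M.
have [g [ghomo gfree Jg]] := extend_free_rows (mxrank_tr Mq) freeJ.
have ginj := increasing_inj ghomo.
pose B := colsub g Mq.
have BT : rowsub g Mq^T = B^T by apply/matrixP => i j; rewrite !mxE.
have rkB : \rank B = \rank Mq by rewrite -mxrank_tr -BT; apply/eqP.
(* Extending the empty set of rows yields a row basis. *)
have [f [fhomo ffree _]] : exists f : 'I_(\rank Mq) -> 'I_m,
    [/\ {homo f : i j / (i < j)%N}, row_free (rowsub f B)
      & forall x, x \in finset.set0 -> x \in codom f].
  apply: extend_free_rows rkB _ => u u0 _.
  by apply/rowP => i; rewrite mxE u0 // inE.
pose N := mxsub f g M.
have NqE : map_mx intr N = rowsub f B :> 'M[rat]_(\rank Mq).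
  by apply/matrixP => i j; rewrite !mxE.
have Nu : N \in unitmx.
  have dN : \det N != 0.
    move: ffree; rewrite row_free_unit -NqE unitmxE unitfE det_map_mx.
    by rewrite intr_eq0.
  by rewrite unitmxE; case: (hM _ _ fhomo ghomo dN) => ->.
pose x : 'cV[int]_n := \col_j (if j \in codom g then 0 else Num.floor (y j 0)).
pose w := rowsub g y.
have yE : y = map_mx intr x + colsub g 1%:M *m w.
  apply/colP => j; rewrite !mxE; case: ifP => [/codomP[k ->]|jg].
    rewrite add0r (bigD1 k) //= big1 ?addr0 => [|i ik]; rewrite !mxE.
      by rewrite eqxx mul1r.
    by rewrite (inj_eq ginj) eq_sym (negPf ik) mul0r.
  rewrite big1 ?addr0 => [|i _]; last first.
    rewrite !mxE; case: eqP => [ji|_]; last by rewrite mul0r.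
    by rewrite ji codom_f in jg.
  rewrite floorK // yint //; apply: contraFN jg; exact: Jg.
have NwE : map_mx intr N *m w = map_mx intr (rowsub f (b - M *m x)).
  have Bw : B *m w = map_mx intr (b - M *m x).
    rewrite map_mxB -yb yE mulmxDr map_mxM addrC addKr mulmxA.
    by rewrite mulmx_colsub mulmx1.
  rewrite NqE mul_rowsub_mx Bw.
  by apply/matrixP => i j; rewrite !mxE.
exists (x + colsub g 1%:M *m (invmx N *m rowsub f (b - M *m x))).
rewrite map_mxD map_mxM map_mxM -NwE (mulmxA (map_mx _ (invmx N))) -map_mxM.
rewrite mulVmx // map_mx1 mul1mx.
rewrite [LHS]yE; congr (_ + _ *m _).
by apply/matrixP => i j; rewrite !mxE; case: (_ == _).
Qed.

(** Walk to a vertex: while the columns at coordinates strictly between their bounds are dependent,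
    move along a kernel vector supported there until a coordinate hits a bound, so that [J y]
    shrinks. At a vertex [unimodular_integral] applies, the coordinates outside [J y] being integer
    bounds. *)
Lemma unimodular_rounding (m n : nat) (M : 'M[int]_(m, n))
    (b : 'cV[int]_m) (l u : 'cV[int]_n) (y : 'cV[rat]_n) :
  unimodular M -> (forall j, (l j 0)%:~R <= y j 0 <= (u j 0)%:~R) ->
  map_mx intr M *m y = map_mx intr b ->
  exists2 z : 'cV[int]_n, (forall j, l j 0 <= z j 0 <= u j 0) & M *m z = b.
Proof.
move=> hM.
pose J (y : 'cV[rat]_n) : {set 'I_n} :=
  finset (fun j => (l j 0)%:~R < y j 0 < (u j 0)%:~R).
have [k] := ubnP #|J y|; elim: k => // k IHk in y * => Jk yb My.
pose A : 'M[rat]_(n, m) := (map_mx intr M)^T.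
have [freeJ | /existsNP[w /not_implyP[w0 /not_implyP[wA /eqP wn0]]]] :=
    pselect (free_rows A (J y)).
  have [|z zE] := unimodular_integral hM freeJ _ My.
    move=> j; rewrite inE !lt_neqAle; case/andP: (yb j) => -> ->.
    rewrite !andbT negb_and !negbK => /orP[/eqP<-|/eqP->]; exact: intr_int.
  exists z => [j|].
    by have := yb j; rewrite zE mxE !ler_int.
  apply/colP => i; apply: (@intr_inj rat); move/colP/(_ i): My.
  by rewrite zE -map_mxM 2!mxE => ->; rewrite mxE.
have [j0 wj0] : exists j, w 0 j != 0.
  apply/existsP; apply: contraNT wn0; rewrite negb_exists => /forallP w00.
  by apply/eqP/rowP => j; rewrite mxE; apply/eqP; rewrite -[_ == _]negbK.
(* [e j] is the bound that coordinate [j] approaches along [w], and [t j] the time of arrival; the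
   minimizer [i] arrives first, so no bound is crossed. *)
pose e j : rat := if 0 < w 0 j then (u j 0)%:~R else (l j 0)%:~R.
pose t j := (e j - y j 0) / w 0 j.
case: (@Order.TotalTheory.arg_minP _ _ _ j0 (fun j => w 0 j != 0) t wj0)
  => i wi ti.
have inJ j : w 0 j != 0 -> (l j 0)%:~R < y j 0 < (u j 0)%:~R.
  by move=> wj; have := contraNT (fun h => introT eqP (w0 j h)) wj; rewrite inE.
have t0 : 0 <= t i.
  have /andP[li ui] := inJ i wi.
  rewrite /t /e; case: ltrP => [wp|wle].
    by apply: divr_ge0; [rewrite subr_ge0 | idtac]; apply: ltW.
  by apply: mulr_le0; rewrite ?invr_le0 // subr_le0; apply: ltW.
pose y' : 'cV[rat]_n := y + t i *: w^T.
have y'E j : y' j 0 = y j 0 + t i * w 0 j by rewrite !mxE.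
have y'i : y' i 0 = e i by rewrite y'E /t mulfVK // addrC subrK.
have y'b j : (l j 0)%:~R <= y' j 0 <= (u j 0)%:~R.
  have [wj|wj] := eqVneq (w 0 j) 0; first by rewrite y'E wj mulr0 addr0.
  have /andP[lj uj] := inJ j wj.
  have := ti j wj; rewrite y'E {2}/t /e; case: ltrP => [wp|wle].
    rewrite ler_pdivlMr // => h; have := mulr_ge0 t0 (ltW wp); lra.
  have wlt : w 0 j < 0 by rewrite lt_neqAle wj.
  rewrite ler_ndivlMr // => h; have := mulr_ge0_le0 t0 wle; lra.
apply: (IHk y') => //; last first.
  rewrite mulmxDr My -scalemxAr.
  have -> : map_mx intr M *m w^T = 0.
    by rewrite -[map_mx _ _]trmxK -trmx_mul wA trmx0.
  by rewrite scaler0 addr0.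
rewrite ltnS in Jk; apply: leq_trans Jk; apply/proper_card/properP; split.
  apply/fintype.subsetP => j; rewrite inE.
  have [wj|wj] := eqVneq (w 0 j) 0; first by rewrite y'E wj mulr0 addr0 inE.
  by rewrite inE inJ.
by exists i; rewrite inE ?inJ // y'i /e; case: ifP => _; rewrite ltxx ?andbF.
Qed.

(** * Counting pairs by their sum or difference *)

(** [W] may be larger than the set of values of [op], so that two products can be expanded over the
    same [W] and compared term by term. *)
Lemma card_fset_pairs (T K : choiceType) (P Q : {fset T}) (op : T -> T -> K)
    (W : {fset K}) :
  (forall x y, x \in P -> y \in Q -> op x y \in W) ->
  (#|` P| * #|` Q| =
   \sum_(w <- W) \sum_(x <- P) \sum_(y <- Q) (op x y == w))%N.
Proof.
move=> PQW; rewrite exchange_big /= card_fset_sum1 big_distrl /=.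
rewrite [LHS]big_seq [RHS]big_seq; apply: eq_bigr => x xP.
rewrite exchange_big /= mul1n card_fset_sum1 [LHS]big_seq [RHS]big_seq.
apply: eq_bigr => y yQ; rewrite (big_fsetD1 (op x y)) ?PQW //= eqxx.
rewrite big_seq big1 // => w; rewrite in_fsetD1 => /andP[/negPf wne _].
by rewrite eq_sym wne.
Qed.

Lemma sum_pairs_card (T K : choiceType) (P Q : {fset T}) (op : T -> T -> K)
    (inv : K -> T -> T) (w : K) :
  (forall x y, (op x y == w) = (y == inv w x)) ->
  (\sum_(x <- P) \sum_(y <- Q) (op x y == w) =
   #|` [fset x in P | inv w x \in Q] |)%fset%N.
Proof.
move=> opE; rewrite card_fset_sum1 big_fset /= [RHS]big_mkcond /=.
apply: eq_bigr => x _; case: ifPn => [xQ|xQ].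
  rewrite (big_fsetD1 (inv w x)) //= opE eqxx big_seq big1 // => y.
  by rewrite in_fsetD1 opE => /andP[/negPf-> _].
rewrite big_seq big1 // => y yQ; rewrite opE.
by case: eqP => // yE; rewrite -yE yQ in xQ.
Qed.

(** * The central fiber of a box *)

(** The max and the min are the ends of the intersection of [[a, b]] with its translate by [w]. This
    lemma locates its center; the next one makes the induction on side lengths decrease. *)
Lemma max_add_min_shift (a b w : int) :
  Num.max a (a + w) + Num.min b (b + w) = a + b + w.
Proof. by rewrite /Num.max /Num.min; do 2 case: ltP => ?; lia. Qed.

Lemma min_shift_sub_max (a b w : int) :
  Num.min b (b + w) - Num.max a (a + w) = b - a - `|w|.
Proof. by rewrite /Num.max /Num.min; do 2 case: ltP => ?; lia. Qed.

(** The induction is on the total side length of the box. [A] may be any part of its fiber, but [C]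
    has to be the whole central one. *)
Lemma card_fiber_le_center (m n : nat) (M : 'M[int]_(m, n)) (l u : 'cV[int]_n)
    (c b : 'cV[int]_m) (A C : {fset 'cV[int]_n}) :
  unimodular M -> M *m (l + u) = b *+ 2 ->
  (forall x, x \in A -> (forall j, l j 0 <= x j 0 <= u j 0) /\ M *m x = c) ->
  (forall x, (x \in C) =
    [forall j, l j 0 <= x j 0 <= u j 0] && (M *m x == b)) ->
  (#|` A| <= #|` C|)%N.
Proof.
move=> hM; have [k] : exists k : nat, \sum_j (u j 0 - l j 0) < k%:Z.
  by exists `|\sum_j (u j 0 - l j 0)|.+1; lia.
elim: k l u A C => [|k IHk] l u A C ltk Mlu inA inC;
  have [->|[a aA]] := fset_0Vmem A; rewrite ?cardfs0 //.
  have [ab _] := inA a aA.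
  have : 0 <= \sum_j (u j 0 - l j 0).
    by apply: sumr_ge0 => j _; have := ab j; lia.
  lia.
have [ab _] := inA a aA.
(* The point [a] forces [l <= u], which puts the midpoint in the box. *)
have C0 : (0 < #|` C|)%N.
  pose y : 'cV[rat]_n := 2^-1 *: map_mx intr (l + u).
  have [j||z zb zM] := @unimodular_rounding _ _ M b l u y hM.
  - have := ab j; rewrite !mxE => /andP[h1 h2].
    have : (l j 0)%:~R <= (u j 0)%:~R :> rat by rewrite ler_int (le_trans h1).
    lra.
  - rewrite -scalemxAr -map_mxM Mlu (mulr2n b) map_mxD.
    apply/colP => i; rewrite !mxE; lra.
  rewrite cardfs_gt0; apply/fset0Pn; exists z.
  by rewrite inC zM eqxx andbT; apply/forallP.
pose W := ([fset x - y | x in A, y in A] `|`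
  [fset x - y | x in C, y in C])%fset.
pose r (X : {fset 'cV[int]_n}) w := (#|` [fset x in X | x - w \in X]|)%fset.
have sumW (X : {fset 'cV[int]_n}) :
    (forall x y, x \in X -> y \in X -> x - y \in W) ->
    (#|` X| * #|` X| = \sum_(w <- W) r X w)%N.
  move=> XW; rewrite (card_fset_pairs XW); apply: eq_bigr => w _.
  apply: (@sum_pairs_card _ _ X X (fun x y => x - y) (fun w x => x - w)) => x y.
  by rewrite subr_eq addrC -subr_eq eq_sym.
have AW x y : x \in A -> y \in A -> x - y \in W.
  move=> xA yA; rewrite in_fsetU; apply/orP; left; apply/imfset2P.
  by exists x => //; exists y.
have CW x y : x \in C -> y \in C -> x - y \in W.
  move=> xC yC; rewrite in_fsetU; apply/orP; right; apply/imfset2P.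
  by exists x => //; exists y.
have W0 : 0 \in W by rewrite -(subrr a) AW.
have r0 X : r X 0 = #|` X|.
  by rewrite /r; congr (#|` _|); apply/fsetP => x; rewrite !inE subr0 andbb.
have le_r w : w != 0 -> (r A w <= r C w)%N.
  move=> wn0; pose l' : 'cV[int]_n := \col_j Num.max (l j 0) (l j 0 + w j 0).
  pose u' : 'cV[int]_n := \col_j Num.min (u j 0) (u j 0 + w j 0).
  rewrite /r; set Aw := (X in (#|` X| <= _)%N).
  have [->|[x]] := fset_0Vmem Aw; first by rewrite cardfs0.
  rewrite !inE /= => /andP[xA xwA].
  have [xb xM] := inA _ xA; have [xwb xwM] := inA _ xwA.
  (* Both [x] and [x - w] lie over [c]. Differences outside the kernel thus do not occur in [A]. *)
  have Mw : M *m w = 0.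
    by move: xwM; rewrite mulmxBr xM -[RHS]subr0 => /addrI/oppr_inj.
  have boxE (z : 'cV[int]_n) :
      (forall j, l' j 0 <= z j 0 <= u' j 0) <->
      (forall j, l j 0 <= z j 0 <= u j 0) /\
      (forall j, l j 0 <= (z - w) j 0 <= u j 0).
    split=> [h|[h1 h2] j].
      split=> j; have := h j; rewrite !mxE ge_max le_min ?lerBrDr ?lerBlDr.
        by case/andP=> /andP[-> _] /andP[-> _].
      by case/andP=> /andP[_ ->] /andP[_ ->].
    have := h1 j; have := h2 j; rewrite !mxE ge_max le_min ?lerBrDr ?lerBlDr.
    by case/andP=> -> -> /andP[-> ->].
  have l'u' : l' + u' = l + u + w.
    by apply/colP => j; rewrite !mxE; apply: max_add_min_shift.
  apply: (IHk l' u').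
  - have [i wi] : exists i, w i 0 != 0.
      apply/existsP; apply: contraNT wn0; rewrite negb_exists => /forallP h.
      by apply/eqP/colP => i; rewrite mxE; apply/eqP; rewrite -[_ == _]negbK.
    suff : \sum_j (u' j 0 - l' j 0) < \sum_j (u j 0 - l j 0) by lia.
    rewrite (bigD1 i) //= [ltRHS](bigD1 i) //=; apply: ltr_leD.
      by rewrite !mxE min_shift_sub_max ltrBlDr ltrDl normr_gt0.
    by apply: ler_sum => j _; rewrite !mxE min_shift_sub_max lerBlDr lerDl.
  - by rewrite l'u' mulmxDr Mlu Mw addr0.
  - move=> z; rewrite !inE /= => /andP[zA zwA].
    have [zb ->] := inA _ zA; have [zwb _] := inA _ zwA.
    by split=> //; apply/boxE.
  - move=> z; rewrite !inE /= !inC mulmxBr Mw subr0.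
    rewrite andbACA andbb; congr (_ && _).
    apply/andP/forallP => [[/forallP h1 /forallP h2]|].
      by apply/boxE.
    by move/boxE => [h1 h2]; split; apply/forallP.
(* Remove the term [w = 0] from both expansions and compare the rest by [le_r]; written additively
   to avoid truncated subtraction. *)
have : (#|` A| * #|` A| + #|` C| <= #|` C| * #|` C| + #|` A|)%N.
  rewrite (sumW A AW) (sumW C CW) (big_fsetD1 0) //= [in leqRHS](big_fsetD1 0) //=.
  rewrite !r0 addnAC [leqRHS]addnAC [X in (_ <= X + _)%N]addnC leq_add2l.
  rewrite big_seq [leqRHS]big_seq; apply: leq_sum => w.
  by rewrite in_fsetD1 => /andP[wn0 _]; apply: le_r.
(* [C0] excludes the case of one point in [A] and none in [C], which satisfies the inequality. *)
nia.
Qed.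

Theorem theorem1p4 (m n : nat) (M : 'M[int]_(m, n)) (hM : unimodular M)
    (b bm bp : 'cV[int]_m)
    (hb : map_mx intr b =
          2^-1 *: (map_mx intr bm + map_mx intr bp) :> 'cV[rat]_m)
    (fin_b : finite_set (nonneg_solutions M b))
    (fin_bm : finite_set (nonneg_solutions M bm))
    (fin_bp : finite_set (nonneg_solutions M bp)) :
  (num_solutions M bm * num_solutions M bp <= num_solutions M b ^ 2)%N.
Proof.
have hb2 : bm + bp = b *+ 2.
  apply/colP => i; move/colP/(_ i): hb; rewrite !mxE => h.
  apply: (@intr_inj rat); rewrite !intrD; lra.
rewrite /num_solutions expnS expn1.
set Ym := fset_set (nonneg_solutions M bm).
set Yp := fset_set (nonneg_solutions M bp).
set Y := fset_set (nonneg_solutions M b).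
have inY c (fin_c : finite_set (nonneg_solutions M c)) x :
    (x \in fset_set (nonneg_solutions M c)) =
    [forall j, 0 <= x j 0] && (M *m x == c).
  rewrite in_fset_set //; apply/idP/andP => [|[/forallP x0 /eqP xc]].
    by rewrite inE => -[x0 ->]; split=> //; apply/forallP.
  by rewrite inE.
(* One index set of sums for both products. *)
pose W := ([fset (x + y)%R | x in Ym, y in Yp] `|`
  [fset (x + y)%R | x in Y, y in Y])%fset.
have inv s (x y : 'cV[int]_n) : (x + y == s) = (y == s - x).
  by rewrite eq_sym [RHS]eq_sym subr_eq addrC.
rewrite (@card_fset_pairs _ _ Ym Yp +%R W) => [|x y xY yY]; last first.
  rewrite in_fsetU; apply/orP; left; apply/imfset2P.
  by exists x => //; exists y.
rewrite (@card_fset_pairs _ _ Y Y +%R W) => [|x y xY yY]; last first.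
  rewrite in_fsetU; apply/orP; right; apply/imfset2P.
  by exists x => //; exists y.
apply: leq_sum => s _.
rewrite !(@sum_pairs_card _ _ _ _ _ (fun s x => s - x)) //.
set A := (X in (#|` X| <= _)%N).
have [->|[a]] := fset_0Vmem A; first by rewrite cardfs0.
rewrite !inE /= !inY // => /andP[/andP[_ /eqP aM] /andP[_ /eqP asM]].
(* A single pair with sum [s] suffices to center the box [[0, s]] over [b]. *)
have Ms : M *m s = b *+ 2 by rewrite -hb2 -aM -asM mulmxBr addrC subrK.
apply: (@card_fiber_le_center _ _ M 0 s bm b) => //.
- by rewrite add0r.
- move=> x; rewrite !inE /= !inY //.
  case/andP=> /andP[/forallP x0 /eqP ->] /andP[/forallP sx0 _].
  by split=> // j; have := sx0 j; rewrite !mxE subr_ge0 x0.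
(* If [x] lies over [b], so does [s - x], as [2 b - b = b]; only the box condition remains. *)
- move=> x; rewrite !inE /= !inY // mulmxBr Ms.
  apply/andP/andP => [[/andP[/forallP x0 xM] /andP[/forallP sx0 _]]|].
    by split=> //; apply/forallP => j; have := sx0 j; rewrite !mxE subr_ge0 x0.
  case=> /forallP xb /eqP xM; rewrite xM mulr2n addrK eqxx !andbT; split;
    apply/forallP => j;
    by have := xb j; rewrite !mxE ?subr_ge0 => /andP[].
Qed.
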